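(* Let $\mathcal{C}$ be a codifferential category with finite coproducts, let $(A,\nu)$ be a $T$-algebra, and let $M$ be an $A$-module with action $\bullet_M:A\otimes M\to M$. A morphism $\partial:A\to M$ in $\mathcal{C}$ is a $T$-derivation if and only if $$\nu;\partial \;=\; d_{TA};(\nu\otimes\partial);\bullet_M : TA\to M .$$
   Context: Composition is written in diagrammatic order: $f;g$ means first $f$, then $g$. Monoidal structures are written as if strict, with unit $k$ and symmetry $c$. An additive symmetric monoidal category is a symmetric monoidal category enriched over commutative monoids (hom-sets have addition and zero, composition is bilinear) whose tensor functor is additive in both variables. In such a category finite coproducts are biproducts, written $\oplus$, with projections $\pi_1,\pi_2$ and pairing $\langle f,g\rangle$. A commutative algebra is a commutative monoid object; modules are left modules. An algebra modality on a symmetric monoidal category consists of a monad $(T,\mu,\eta)$ and, for each object $C$, morphisms $m:TC\otimes TC\to TC$, $e:k\to TC$ making $TC$ a commutative algebra, such that $m,e$ are natural in $C$ (each $Tf$ is an algebra homomorphism) and each $\mu_C:T^2C\to TC$ is an algebra homomorphism. A codifferential category is an additive symmetric monoidal category with an algebra modality $T$ and a deriving transform, i.e. a transformation $d_{TC}:TC\to TC\otimes C$, natural in $C$, such that: (d1) $e;d=0$; (d2) $m;d=(1\otimes d);(m\otimes 1)+(d\otimes 1);c;(m\otimes 1)$, where $c$ here is the symmetry $TC\otimes C\otimes TC\to TC\otimes TC\otimes C$; (d3) $\eta;d=e\otimes 1$; (d4) $\mu_C;d_{TC}=d_{T^2C};(\mu_C\otimes d_{TC});(m\otimes 1_C)$.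 Each $T$-algebra $(A,\nu)$ has an associated commutative algebra structure with multiplication $(\eta_A\otimes\eta_A);m;\nu$ and unit $e;\nu$; an $A$-module is a module over it. For a $T$-algebra $(A,\nu)$ and an $A$-module $M$, $W(A,M)$ is the $T$-algebra $(A\oplus M,\beta)$ with $\beta=\langle\beta_1,\beta_2\rangle:T(A\oplus M)\to A\oplus M$, $\beta_1=T\pi_1;\nu$ and $\beta_2=d_{T(A\oplus M)};(T\pi_1\otimes\pi_2);(\nu\otimes 1_M);\bullet_M$. A $T$-derivation is a morphism $\partial:A\to M$ in $\mathcal{C}$ such that $\langle 1_A,\partial\rangle:A\to A\oplus M$ is a $T$-algebra homomorphism $A\to W(A,M)$. *)

(* Defs.v *)
From mathcomp Require Import ssreflect ssrfun bigop.

Set Implicit Arguments.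
Unset Strict Implicit.
Unset Printing Implicit Defensive.

Declare Scope cat_scope.
Delimit Scope cat_scope with cat.
Local Open Scope cat_scope.

Reserved Notation "X ~> Y" (at level 90, Y at level 89, no associativity).
Reserved Notation "f ;; g" (at level 50, left associativity).
Reserved Notation "X ⊗ Y" (at level 40, left associativity).
Reserved Notation "f ⊗₁ g" (at level 40, left associativity).

(* Composition is diagrammatic: f ;; g is first f, then g. *)
Record category := Category {
  ob :> Type;
  hom : ob -> ob -> Type;
  idm : forall X, hom X X;
  compm : forall X Y Z, hom X Y -> hom Y Z -> hom X Z;
  comp1m : forall X Y (f : hom X Y), compm (idm X) f = f;
  compm1 : forall X Y (f : hom X Y), compm f (idm Y) = f;
  compmA : forall W X Y Z (f : hom W X) (g : hom X Y) (h : hom Y Z),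
    compm f (compm g h) = compm (compm f g) h
}.

Arguments hom {_} _ _.
Arguments idm {_} _.
Notation "X ~> Y" := (hom X Y) : type_scope.
Notation "f ;; g" := (compm f g) : cat_scope.

(* Not assumed strict: the associator alpha, the unitors lam and rho and their
   inverses (suffix V) are part of the structure. *)
Record symMonCat := SymMonCat {
  smc_cat :> category;
  tens : smc_cat -> smc_cat -> smc_cat
    where "X ⊗ Y" := (tens X Y);
  unitob : smc_cat;
  tensm : forall X Y X' Y' : smc_cat,
    (X ~> X') -> (Y ~> Y') -> (X ⊗ Y ~> X' ⊗ Y')
    where "f ⊗₁ g" := (tensm f g);
  tensm1 : forall X Y : smc_cat, idm X ⊗₁ idm Y = idm (X ⊗ Y);
  tensm_comp : forall (X X' X'' Y Y' Y'' : smc_cat)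
    (f : X ~> X') (f' : X' ~> X'') (g : Y ~> Y') (g' : Y' ~> Y''),
    (f ;; f') ⊗₁ (g ;; g') = (f ⊗₁ g) ;; (f' ⊗₁ g');
  alpha : forall X Y Z : smc_cat, X ⊗ Y ⊗ Z ~> X ⊗ (Y ⊗ Z);
  alphaV : forall X Y Z : smc_cat, X ⊗ (Y ⊗ Z) ~> X ⊗ Y ⊗ Z;
  alphaK : forall X Y Z, alpha X Y Z ;; alphaV X Y Z = idm _;
  alphaVK : forall X Y Z, alphaV X Y Z ;; alpha X Y Z = idm _;
  alpha_nat : forall (X X' Y Y' Z Z' : smc_cat)
    (f : X ~> X') (g : Y ~> Y') (h : Z ~> Z'),
    (f ⊗₁ g ⊗₁ h) ;; alpha X' Y' Z' = alpha X Y Z ;; (f ⊗₁ (g ⊗₁ h));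
  lam : forall X : smc_cat, unitob ⊗ X ~> X;
  lamV : forall X : smc_cat, X ~> unitob ⊗ X;
  lamK : forall X, lam X ;; lamV X = idm _;
  lamVK : forall X, lamV X ;; lam X = idm _;
  lam_nat : forall (X Y : smc_cat) (f : X ~> Y),
    (idm unitob ⊗₁ f) ;; lam Y = lam X ;; f;
  rho : forall X : smc_cat, X ⊗ unitob ~> X;
  rhoV : forall X : smc_cat, X ~> X ⊗ unitob;
  rhoK : forall X, rho X ;; rhoV X = idm _;
  rhoVK : forall X, rhoV X ;; rho X = idm _;
  rho_nat : forall (X Y : smc_cat) (f : X ~> Y),
    (f ⊗₁ idm unitob) ;; rho Y = rho X ;; f;
  sym : forall X Y : smc_cat, X ⊗ Y ~> Y ⊗ X;
  symK : forall X Y, sym X Y ;; sym Y X = idm _;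
  sym_nat : forall (X X' Y Y' : smc_cat) (f : X ~> X') (g : Y ~> Y'),
    (f ⊗₁ g) ;; sym X' Y' = sym X Y ;; (g ⊗₁ f);
  triangle : forall X Y,
    alpha X unitob Y ;; (idm X ⊗₁ lam Y) = rho X ⊗₁ idm Y;
  pentagon : forall W X Y Z,
    alpha (W ⊗ X) Y Z ;; alpha W X (Y ⊗ Z)
    = (alpha W X Y ⊗₁ idm Z) ;; alpha W (X ⊗ Y) Z ;; (idm W ⊗₁ alpha X Y Z);
  hexagon : forall X Y Z,
    alpha X Y Z ;; sym X (Y ⊗ Z) ;; alpha Y Z X
    = (sym X Y ⊗₁ idm Z) ;; alpha Y X Z ;; (idm Y ⊗₁ sym X Z)
}.

Arguments unitob {_}.
Arguments alpha {_} _ _ _.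
Arguments alphaV {_} _ _ _.
Arguments lam {_} _.
Arguments lamV {_} _.
Arguments rho {_} _.
Arguments rhoV {_} _.
Arguments sym {_} _ _.
Notation "X ⊗ Y" := (tens X Y) : cat_scope.
Notation "f ⊗₁ g" := (tensm f g) : cat_scope.

Record is_comAlgebra (C : symMonCat) (A : C) (mul : A ⊗ A ~> A)
    (one : unitob ~> A) : Prop := IsComAlgebra {
  alg_assoc : (mul ⊗₁ idm A) ;; mul = alpha A A A ;; (idm A ⊗₁ mul) ;; mul;
  alg_unitl : (one ⊗₁ idm A) ;; mul = lam A;
  alg_unitr : (idm A ⊗₁ one) ;; mul = rho A;
  alg_comm : sym A A ;; mul = mul
}.

Record is_algHom (C : symMonCat) (A B : C)
    (mulA : A ⊗ A ~> A) (oneA : unitob ~> A)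
    (mulB : B ⊗ B ~> B) (oneB : unitob ~> B) (f : A ~> B) : Prop := IsAlgHom {
  algHom_mul : mulA ;; f = (f ⊗₁ f) ;; mulB;
  algHom_one : oneA ;; f = oneB
}.

Record is_module (C : symMonCat) (A : C) (mul : A ⊗ A ~> A)
    (one : unitob ~> A) (M : C) (mact : A ⊗ M ~> M) : Prop := IsModule {
  module_assoc : (mul ⊗₁ idm M) ;; mact = alpha A A M ;; (idm A ⊗₁ mact) ;; mact;
  module_unit : (one ⊗₁ idm M) ;; mact = lam M
}.

Record addSymMonCat := AddSymMonCat {
  asmc_smc :> symMonCat;
  zerom : forall X Y : asmc_smc, X ~> Y;
  addm : forall X Y : asmc_smc, Monoid.com_law (zerom X Y);
  comp_addl : forall (X Y Z : asmc_smc) (f g : X ~> Y) (h : Y ~> Z),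
    addm _ _ f g ;; h = addm _ _ (f ;; h) (g ;; h);
  comp_addr : forall (X Y Z : asmc_smc) (f : X ~> Y) (g h : Y ~> Z),
    f ;; addm _ _ g h = addm _ _ (f ;; g) (f ;; h);
  comp_0l : forall (X Y Z : asmc_smc) (h : Y ~> Z), zerom X Y ;; h = zerom X Z;
  comp_0r : forall (X Y Z : asmc_smc) (f : X ~> Y), f ;; zerom Y Z = zerom X Z;
  tens_addl : forall (X X' Y Y' : asmc_smc) (f g : X ~> X') (h : Y ~> Y'),
    addm _ _ f g ⊗₁ h = addm _ _ (f ⊗₁ h) (g ⊗₁ h);
  tens_addr : forall (X X' Y Y' : asmc_smc) (f : X ~> X') (g h : Y ~> Y'),
    f ⊗₁ addm _ _ g h = addm _ _ (f ⊗₁ g) (f ⊗₁ h);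
  tens_0l : forall (X X' Y Y' : asmc_smc) (h : Y ~> Y'),
    zerom X X' ⊗₁ h = zerom _ _;
  tens_0r : forall (X X' Y Y' : asmc_smc) (f : X ~> X'),
    f ⊗₁ zerom Y Y' = zerom _ _
}.

Arguments zerom {_ _ _}.
Arguments addm {_ _ _}.

Record monad (C : category) := Monad {
  T0 :> C -> C;
  Tm : forall X Y : C, (X ~> Y) -> (T0 X ~> T0 Y);
  Tm1 : forall X, Tm (idm X) = idm (T0 X);
  Tm_comp : forall (X Y Z : C) (f : X ~> Y) (g : Y ~> Z),
    Tm (f ;; g) = Tm f ;; Tm g;
  mu : forall X : C, T0 (T0 X) ~> T0 X;
  mu_nat : forall (X Y : C) (f : X ~> Y), mu X ;; Tm f = Tm (Tm f) ;; mu Y;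
  eta : forall X : C, X ~> T0 X;
  eta_nat : forall (X Y : C) (f : X ~> Y), eta X ;; Tm f = f ;; eta Y;
  monad_unitl : forall X, eta (T0 X) ;; mu X = idm (T0 X);
  monad_unitr : forall X, Tm (eta X) ;; mu X = idm (T0 X);
  monad_assoc : forall X, Tm (mu X) ;; mu X = mu (T0 X) ;; mu X
}.

Arguments Tm {_} _ {_ _} _.
Arguments mu {_} _ _.
Arguments eta {_} _ _.

Record algModality (C : symMonCat) := AlgModality {
  am_monad :> monad C;
  tmul : forall X : C, am_monad X ⊗ am_monad X ~> am_monad X;
  tone : forall X : C, unitob ~> am_monad X;
  tmulP : forall X, is_comAlgebra (tmul X) (tone X);
  Tm_algHom : forall (X Y : C) (f : X ~> Y),
    is_algHom (tmul X) (tone X) (tmul Y) (tone Y) (Tm am_monad f);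
  mu_algHom : forall X,
    is_algHom (tmul (am_monad X)) (tone (am_monad X)) (tmul X) (tone X)
      (mu am_monad X)
}.

Arguments tmul {_} _ _.
Arguments tone {_} _ _.

(* The symmetry interchanging the last two factors of X ⊗ Y ⊗ Z. *)
Definition symr (C : symMonCat) (X Y Z : C) : X ⊗ Y ⊗ Z ~> X ⊗ Z ⊗ Y :=
  alpha X Y Z ;; (idm X ⊗₁ sym Y Z) ;; alphaV X Z Y.

Record codiffCat := CodiffCat {
  cd_asmc :> addSymMonCat;
  TT : algModality cd_asmc;
  deriv : forall X : cd_asmc, TT X ~> TT X ⊗ X;
  deriv_nat : forall (X Y : cd_asmc) (f : X ~> Y),
    Tm TT f ;; deriv Y = deriv X ;; (Tm TT f ⊗₁ f);
  deriv_const : forall X, tone TT X ;; deriv X = zerom;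
  deriv_mul : forall X,
    tmul TT X ;; deriv X
    = addm ((idm (TT X) ⊗₁ deriv X) ;; alphaV _ _ _ ;; (tmul TT X ⊗₁ idm X))
           ((deriv X ⊗₁ idm (TT X)) ;; symr _ _ _ ;; (tmul TT X ⊗₁ idm X));
  deriv_lin : forall X, eta TT X ;; deriv X = lamV X ;; (tone TT X ⊗₁ idm X);
  deriv_chain : forall X,
    mu TT X ;; deriv X
    = deriv (TT X) ;; (mu TT X ⊗₁ deriv X) ;; alphaV _ _ _
      ;; (tmul TT X ⊗₁ idm X)
}.

Arguments TT {_}.
Arguments deriv {_} _.

Record finCoproducts (C : category) := FinCoproducts {
  initob : C;
  initm : forall X : C, initob ~> X;
  initm_uniq : forall (X : C) (f : initob ~> X), f = initm X;
  coprod : C -> C -> C;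
  inj1 : forall X Y : C, X ~> coprod X Y;
  inj2 : forall X Y : C, Y ~> coprod X Y;
  copair : forall X Y Z : C, (X ~> Z) -> (Y ~> Z) -> (coprod X Y ~> Z);
  inj1_copair : forall (X Y Z : C) (f : X ~> Z) (g : Y ~> Z),
    inj1 X Y ;; copair f g = f;
  inj2_copair : forall (X Y Z : C) (f : X ~> Z) (g : Y ~> Z),
    inj2 X Y ;; copair f g = g;
  copair_uniq : forall (X Y Z : C) (f : X ~> Z) (g : Y ~> Z)
    (h : coprod X Y ~> Z),
    inj1 X Y ;; h = f -> inj2 X Y ;; h = g -> h = copair f g
}.

Arguments coprod {_} _ _ _.
Arguments inj1 {_} _ _ _.
Arguments inj2 {_} _ _ _.
Arguments copair {_} _ {_ _ _} _ _.

(* In an additive category the coproduct is a biproduct; pair_pi1, pair_pi2 and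
   pair_uniq below say that pi1, pi2 and pairm make it a product. *)
Section Biproducts.
Variables (C : addSymMonCat) (cop : finCoproducts C).
Implicit Types X Y Z : C.

Definition pi1 X Y : coprod cop X Y ~> X := copair cop (idm X) zerom.
Definition pi2 X Y : coprod cop X Y ~> Y := copair cop zerom (idm Y).
Definition pairm Z X Y (f : Z ~> X) (g : Z ~> Y) : Z ~> coprod cop X Y :=
  addm (f ;; inj1 cop X Y) (g ;; inj2 cop X Y).

Lemma pair_pi1 Z X Y (f : Z ~> X) (g : Z ~> Y) : pairm f g ;; pi1 X Y = f.
Proof.
rewrite /pairm /pi1 comp_addl -!compmA inj1_copair inj2_copair compm1 comp_0r.
exact: Monoid.mulm1.
Qed.

Lemma pair_pi2 Z X Y (f : Z ~> X) (g : Z ~> Y) : pairm f g ;; pi2 X Y = g.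
Proof.
rewrite /pairm /pi2 comp_addl -!compmA inj1_copair inj2_copair compm1 comp_0r.
exact: Monoid.mul1m.
Qed.

Lemma pair_pi X Y : pairm (pi1 X Y) (pi2 X Y) = idm _.
Proof.
rewrite [RHS](copair_uniq (compm1 _) (compm1 _)); apply: copair_uniq.
  rewrite /pairm comp_addr !compmA /pi1 /pi2 !inj1_copair comp1m comp_0l.
  exact: Monoid.mulm1.
rewrite /pairm comp_addr !compmA /pi1 /pi2 !inj2_copair comp1m comp_0l.
exact: Monoid.mul1m.
Qed.

Lemma pair_uniq Z X Y (f : Z ~> X) (g : Z ~> Y) (h : Z ~> coprod cop X Y) :
  h ;; pi1 X Y = f -> h ;; pi2 X Y = g -> h = pairm f g.
Proof.
move=> <- <-; rewrite -[LHS]compm1 -pair_pi /pairm comp_addr.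
by rewrite !compmA.
Qed.

End Biproducts.

Arguments pi1 {_} _ _ _.
Arguments pi2 {_} _ _ _.
Arguments pairm {_} _ {_ _ _} _ _.

Record talgebra (C : category) (T : monad C) := TAlgebra {
  talg_ob :> C;
  nu : T talg_ob ~> talg_ob;
  nu_unit : eta T talg_ob ;; nu = idm talg_ob;
  nu_assoc : mu T talg_ob ;; nu = Tm T nu ;; nu
}.

Arguments nu {_ _} _.

Definition is_talgHom (C : category) (T : monad C) (A B : talgebra T)
    (f : A ~> B) : Prop :=
  nu A ;; f = Tm T f ;; nu B.

Section AssociatedAlgebra.
Variables (C : symMonCat) (T : algModality C) (A : talgebra T).

Definition amul : A ⊗ A ~> A :=
  (eta T A ⊗₁ eta T A) ;; tmul T A ;; nu A.
Definition aone : unitob ~> A := tone T A ;; nu A.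

Lemma nu_amul : tmul T A ;; nu A = (nu A ⊗₁ nu A) ;; amul.
Proof.
rewrite /amul !compmA -tensm_comp -!eta_nat tensm_comp.
rewrite -(compmA _ _ (tmul T A)) -(algHom_mul (Tm_algHom T (nu A))).
rewrite -!compmA -nu_assoc (compmA (tmul T _)) (algHom_mul (mu_algHom T A)).
by rewrite -compmA compmA -tensm_comp !monad_unitl tensm1 comp1m.
Qed.

Lemma amulP : is_comAlgebra amul aone.
Proof.
have [mA m1l m1r mC] := tmulP T A.
have amulC : sym A A ;; amul = amul.
  by rewrite /amul !compmA -sym_nat -(compmA _ _ (tmul T A)) mC.
move: amul amulC nu_amul => b bC nuE; split=> //.
- have H : (nu A ⊗₁ nu A ⊗₁ nu A) ;; ((b ⊗₁ idm A) ;; b)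
         = (nu A ⊗₁ nu A ⊗₁ nu A)
           ;; (alpha A A A ;; (idm A ⊗₁ b) ;; b).
    rewrite !compmA -tensm_comp compm1 -nuE alpha_nat.
    rewrite -(compmA (alpha _ _ _)) -tensm_comp compm1 -nuE.
    have -> : (tmul T A ;; nu A) ⊗₁ nu A
      = (tmul T A ⊗₁ idm _) ;; (nu A ⊗₁ nu A).
      by rewrite -tensm_comp comp1m.
    have -> : nu A ⊗₁ (tmul T A ;; nu A)
      = (idm _ ⊗₁ tmul T A) ;; (nu A ⊗₁ nu A).
      by rewrite -tensm_comp comp1m.
    by rewrite -!compmA -nuE !compmA mA.
  have := congr1 (compm (eta T A ⊗₁ eta T A ⊗₁ eta T A)) H.
  by rewrite !(compmA (_ ⊗₁ _ ⊗₁ _) (_ ⊗₁ _ ⊗₁ _)) -!tensm_comp !nu_unit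
             !tensm1 !comp1m.
- have -> : aone ⊗₁ idm A
    = (idm _ ⊗₁ eta T A) ;; (tone T A ⊗₁ idm _) ;; (nu A ⊗₁ nu A).
    by rewrite -!tensm_comp !comp1m compm1 nu_unit.
  rewrite -!compmA -nuE (compmA (tone T A ⊗₁ _)) m1l compmA lam_nat.
  by rewrite -compmA nu_unit compm1.
- have -> : idm A ⊗₁ aone
    = (eta T A ⊗₁ idm _) ;; (idm _ ⊗₁ tone T A) ;; (nu A ⊗₁ nu A).
    by rewrite -!tensm_comp !comp1m compm1 nu_unit.
  rewrite -!compmA -nuE (compmA (_ ⊗₁ tone T A)) m1r compmA rho_nat.
  by rewrite -compmA nu_unit compm1.
Qed.

Record amodule := AModule {
  mod_ob :> C;
  mact : A ⊗ mod_ob ~> mod_ob;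
  actP : is_module amul aone mact
}.

End AssociatedAlgebra.

Arguments mact {_ _ _} _.

Section SquareZeroExtension.
Variables (C : codiffCat) (cop : finCoproducts C).
Variables (A : talgebra (@TT C)) (M : amodule A).

Let AM := coprod cop A M.

Definition beta1 : TT AM ~> A := Tm TT (pi1 cop A M) ;; nu A.
Definition beta2 : TT AM ~> M :=
  deriv AM ;; (Tm TT (pi1 cop A M) ⊗₁ pi2 cop A M) ;; (nu A ⊗₁ idm M) ;; mact M.
Definition beta : TT AM ~> AM := pairm cop beta1 beta2.

Lemma pair_ext (Z : C) (f g : Z ~> AM) :
  f ;; pi1 cop A M = g ;; pi1 cop A M ->
  f ;; pi2 cop A M = g ;; pi2 cop A M -> f = g.
Proof. by move=> /pair_uniq e1 /e1 ->; apply/esym/pair_uniq. Qed.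

Lemma beta_unit : eta TT AM ;; beta = idm AM.
Proof.
apply: pair_ext; rewrite -!compmA ?pair_pi1 ?pair_pi2 comp1m.
  by rewrite /beta1 compmA eta_nat -compmA nu_unit compm1.
rewrite /beta2 !compmA deriv_lin -!(compmA (lamV _)) -!tensm_comp comp1m compm1.
rewrite (algHom_one (Tm_algHom _ _)).
have -> : (tone TT A ;; nu A) ⊗₁ pi2 cop A M
  = (idm _ ⊗₁ pi2 cop A M) ;; (aone A ⊗₁ idm M).
  by rewrite -tensm_comp comp1m compm1.
rewrite -!compmA (module_unit (actP M)) lam_nat compmA lamVK.
by rewrite comp1m.
Qed.

Lemma beta_assoc : mu TT AM ;; beta = Tm TT beta ;; beta.
Proof.
apply: pair_ext; rewrite -!compmA ?pair_pi1 ?pair_pi2.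
  rewrite {2}/beta1 (compmA (Tm TT beta)) -Tm_comp pair_pi1 {2}/beta1 Tm_comp.
  by rewrite -compmA -nu_assoc !compmA -mu_nat -compmA.
have beta2E : beta2 = deriv AM ;; (beta1 ⊗₁ pi2 cop A M) ;; mact M.
  by rewrite /beta2 -(compmA (deriv _)) -tensm_comp compm1.
have Tbeta1 : Tm TT beta ;; beta1 = mu TT AM ;; beta1.
  rewrite {2}/beta1 compmA -Tm_comp pair_pi1 /beta1 Tm_comp.
  by rewrite -compmA -nu_assoc !compmA -mu_nat.
have beta1_mul : tmul TT AM ;; beta1 = (beta1 ⊗₁ beta1) ;; amul A.
  rewrite /beta1 compmA (algHom_mul (Tm_algHom _ _)) -compmA nu_amul compmA.
  by rewrite -tensm_comp.
have beta_pi2 : beta ;; pi2 cop A M = beta2 by exact: pair_pi2.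
move: beta beta1 beta2 (amul A) (actP M) beta2E Tbeta1 beta1_mul beta_pi2.
move=> b b1 b2 mulA [MA _] b2E Tb1 b1M b2pi.
have {2}-> : b2 = deriv AM ;; (b1 ⊗₁ pi2 cop A M) ;; mact M by [].
rewrite !compmA deriv_nat -(compmA (deriv _)) -tensm_comp b2pi Tb1.
rewrite b2E !compmA deriv_chain -(compmA _ (tmul _ _ ⊗₁ _)) -tensm_comp comp1m.
have -> : (tmul TT AM ;; b1) ⊗₁ pi2 cop A M
  = (b1 ⊗₁ b1 ⊗₁ pi2 cop A M) ;; (mulA ⊗₁ idm M).
  by rewrite -tensm_comp compm1 b1M.
rewrite -(compmA _ _ (mact M)) -(compmA (_ ⊗₁ _ ⊗₁ _)) MA.
rewrite !compmA -(compmA _ (_ ⊗₁ _ ⊗₁ _)) alpha_nat compmA -(compmA _ (alphaV _ _ _)).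
rewrite alphaVK compm1 -!(compmA (deriv _)) -!tensm_comp compm1.
by rewrite (compmA (deriv AM)) -b2E.
Qed.

Definition W : talgebra (@TT C) := TAlgebra beta_unit beta_assoc.

Definition is_tderivation (del : A ~> M) : Prop :=
  is_talgHom (B := W) (pairm cop (idm A) del).

End SquareZeroExtension.

(* Main.v *)
From mathcomp Require Import ssreflect.
Require Import Defs.

Local Open Scope cat_scope.

(** Both sides of the homomorphism equation for [pairm cop (idm A) del] land in a biproduct, so they
    are compared componentwise. The [A]-components are both [nu A], whatever [del] is; the
    [M]-components are the two sides of the Leibniz-type equation. *)

Lemma Tm_pairm_beta (C : codiffCat) (cop : finCoproducts C)
    (A : talgebra (@TT C)) (M : amodule A) (del : A ~> M) :
  Tm TT (pairm cop (idm A) del) ;; beta cop M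
  = pairm cop (nu A) (deriv A ;; (nu A ⊗₁ del) ;; mact M).
Proof.
apply: pair_ext; rewrite -(compmA (Tm _ _)) !(pair_pi1, pair_pi2).
  by rewrite /beta1 compmA -Tm_comp pair_pi1 Tm1 comp1m.
(* Naturality of [deriv] carries the pairing into both tensor factors, where the projections reduce
   it to [idm] and [del]. *)
rewrite /beta2 !compmA deriv_nat -!(compmA (deriv A)) -!tensm_comp.
by rewrite -Tm_comp pair_pi1 pair_pi2 Tm1 comp1m compm1.
Qed.

Theorem proposition4p11 (C : codiffCat) (cop : finCoproducts C)
    (A : talgebra (@TT C)) (M : amodule A) (del : A ~> M) :
  is_tderivation cop del <->
  nu A ;; del = deriv A ;; (nu A ⊗₁ del) ;; mact M.
Proof.
rewrite /is_tderivation /is_talgHom /= Tm_pairm_beta.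
split=> [/(f_equal (fun f => f ;; pi2 cop A M))|H].
  by rewrite -compmA !pair_pi2.
by apply: pair_ext; rewrite -compmA !(pair_pi1, pair_pi2) ?compm1.
Qed.
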